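(* Put $N_d(k)=\binom{d+k-1}{k}+\binom{d+k-2}{k-1}$ and $N'_d(k)=2\binom{d+k-2}{k-1}$. (i) Let $X$ be a locally $k$-distance set on $S^{d-1}$. If $|X|=N_d(k)$, then $X$ is a $k$-distance set. (ii) Let $X$ be an antipodal locally $k$-distance set on $S^{d-1}$. If $|X|=N'_d(k)$, then $X$ is a $k$-distance set.
   Context: Here $d$ and $k$ are positive integers, $S^{d-1}$ is the unit sphere in $\mathbb{R}^d$, and $d(x,y)$ is the Euclidean distance. For $X\subset\mathbb{R}^d$ let $A(X)=\{d(x,y): x,y\in X,\ x\ne y\}$ and, for $x\in X$, $A_X(x)=\{d(x,y): y\in X,\ y\neq x\}$. $X$ is a $k$-distance set if $|A(X)|=k$, and a locally $k$-distance set if $|A_X(x)|\le k$ for all $x\in X$. $X$ is antipodal if $-x\in X$ for every $x\in X$.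
   Formalization: The case d = 1 with k ≥ 2 is excluded, because there N_1(k) = N'_1(k) = 2 and X = {−1, 1} is an antipodal locally k-distance set with only one distance, so both parts fail as stated. *)

(* Defs.v *)
From mathcomp Require Import all_boot all_order all_algebra.
From mathcomp Require Import classical_sets cardinality reals.

Set Implicit Arguments.
Unset Strict Implicit.
Unset Printing Implicit Defensive.

Import Order.TTheory GRing.Theory Num.Theory.
Local Open Scope classical_set_scope.
Local Open Scope card_scope.
Local Open Scope ring_scope.

(* MathComp-Analysis equips 'rV[R]_d with the sup norm, so `|x| is not the
   Euclidean norm. *)
Definition edist (R : realType) (d : nat) (x y : 'rV[R]_d) : R :=
  Num.sqrt (\sum_(i < d) (x 0 i - y 0 i) ^+ 2).

Definition unit_sphere (R : realType) (d : nat) : set 'rV[R]_d :=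
  [set x | edist x 0 = 1].
Arguments unit_sphere : clear implicits.

Definition distances (R : realType) (d : nat) (X : set 'rV[R]_d) : set R :=
  [set r | exists x y, [/\ X x, X y, x <> y & r = edist x y]].

Definition distances_from (R : realType) (d : nat) (X : set 'rV[R]_d)
    (x : 'rV[R]_d) : set R :=
  [set r | exists y, [/\ X y, y <> x & r = edist x y]].

Definition k_distance_set (R : realType) (d k : nat) (X : set 'rV[R]_d) : Prop :=
  distances X #= `I_k.

Definition locally_k_distance_set (R : realType) (d k : nat)
    (X : set 'rV[R]_d) : Prop :=
  forall x, X x -> distances_from X x #<= `I_k.

Definition antipodal (R : realType) (d : nat) (X : set 'rV[R]_d) : Prop :=
  forall x, X x -> X (- x).

(* The subtractions in both bounds are exact for d, k >= 1. *)
Definition Nbound (d k : nat) : nat :=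
  ('C(d + k - 1, k) + 'C(d + k - 2, k - 1))%N.

Definition Nbound_antipodal (d k : nat) : nat :=
  (2 * 'C(d + k - 2, k - 1))%N.

(* Main.v *)
Require Import Defs.
From mathcomp Require Import all_boot all_order all_algebra.
From mathcomp Require Import classical_sets cardinality reals.
From mathcomp Require Import complex ring lra zify.

(** For a point [x] of [X] let [F_x] be the product of the functions
    [dot x z - c] over the inner products [c] of [x] with the other points of
    [X], padded with factors [dot x z] up to degree [n = k], and scaled by a
    weight [v_x] so that [F_x x = 1]. In the antipodal case the inner product
    [-1] is left out, [n = k - 1], and the weight of an antipodal pair is shared
    equally by its two points. The [F_x] are the Lagrange basis at the
    points of [X] (at one point of each antipodal pair) inside a space of
    functions on the sphere spanned by as many monomials as there are points,
    so every polynomial [p] of that space satisfies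
    [p = sum_x p(x) F_x] ([interpolation]).

    The aim is to show that the monic polynomials [M_x] of degree [n], such that
    [F_x z = v_x M_x(dot x z)], agree at all inner products of [X]: then each
    inner product between points of [X] is a root of any single [M_x].
    This follows once the moments [sum_x v_x (dot x a)^m] with [m <= 2n] depend
    on the vector [a] only through its length. Indeed, polarization then makes
    [sum_t v_t f(dot t a) g(dot t b)] depend only on the Gram matrix of [a] and
    [b] when [f] and [g] have degree at most [n], and for [f = M_y], [g = M_x]
    this sum can be evaluated by the defining property of the Lagrange basis,
    both at the pair [y], [b] and at its mirror image under the reflection
    exchanging [b] and [x] ([node_polys_agree]).

    The rotation invariance of the moments is obtained over the complex numbers,
    where the interpolation identity holds on the whole quadric [dot z z = 1].
    Letting [z] go to infinity along an isotropic direction keeps only the parts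
    of top degree ([top_form]) and shows that the signed measure with weights
    [v_x] annihilates [(dot x z)^n q(x)] for isotropic [z] and [q] of degree less
    than [n]. Moving [z] inside the isotropic cone and averaging, this goes down
    from [n] to every smaller positive exponent ([kills_isotropic_pred]).
    Writing two vectors of the same length as combinations of the two isotropic
    vectors of their plane, only balanced products survive in the binomial
    expansion of their moments, and those have equal coefficients
    ([moment_eq]).

    Finally, a point [x] cannot see fewer distances than allowed: otherwise
    one linear factor [dot u z], with [u] orthogonal to [x], would fit into the
    degree bound and give a nonzero polynomial vanishing on [X]
    ([size_roots_eq]). *)

Set Implicit Arguments.
Unset Strict Implicit.
Unset Printing Implicit Defensive.
Import Order.TTheory GRing.Theory Num.Theory.
Local Open Scope ring_scope.

(** * The bilinear dot product *)

Definition dot (K : fieldType) (d : nat) (u v : 'rV[K]_d) : K :=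
  \sum_(i < d) u 0 i * v 0 i.

Section Dot.
Variables (K : fieldType) (d : nat).
Implicit Types (u v w : 'rV[K]_d) (a : K).

Lemma dotC u v : dot u v = dot v u.
Proof. by apply: eq_bigr => i _; rewrite mulrC. Qed.

Lemma dotDl u v w : dot (u + v) w = dot u w + dot v w.
Proof. by rewrite -big_split; apply: eq_bigr => i _; rewrite mxE mulrDl. Qed.

Lemma dotZl a u v : dot (a *: u) v = a * dot u v.
Proof. by rewrite /dot mulr_sumr; apply: eq_bigr => i _; rewrite mxE mulrA. Qed.

Lemma dotDr u v w : dot u (v + w) = dot u v + dot u w.
Proof. by rewrite dotC dotDl !(dotC _ u). Qed.

Lemma dotZr a u v : dot u (a *: v) = a * dot u v.
Proof. by rewrite dotC dotZl dotC. Qed.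

Lemma dotNl u v : dot (- u) v = - dot u v.
Proof. by rewrite -scaleN1r dotZl mulN1r. Qed.

Lemma dotNr u v : dot u (- v) = - dot u v.
Proof. by rewrite dotC dotNl dotC. Qed.

Lemma dot0l v : dot 0 v = 0.
Proof. by rewrite -(scale0r v) dotZl mul0r. Qed.

Lemma dot0r v : dot v 0 = 0.
Proof. by rewrite dotC dot0l. Qed.

Lemma dot_delta v i : dot v (delta_mx 0 i) = v 0 i.
Proof.
rewrite /dot (bigD1 i) //= mxE !eqxx mulr1 big1 ?addr0 // => j ji.
by rewrite mxE (negbTE ji) andbF mulr0.
Qed.

Definition dotE := (dotDl, dotDr, dotNl, dotNr, dotZl, dotZr).

End Dot.

(** * Polynomial functions on a quadric and interpolation *)

Section PolynomialFunctions.
Variables (K : fieldType) (d : nat).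
Implicit Types (f g : 'rV[K]_d -> K) (n : nat).

(** Only values on the quadric [dot x x = 1] count, so that forms of different
    degrees of the same parity can be compared. *)
Definition spanned (J : finType) (e : J -> 'rV[K]_d -> K) f :=
  exists c : J -> K, forall x, dot x x = 1 -> f x = \sum_j c j * e j x.

Section Spanned.
Variables (J : finType) (e : J -> 'rV[K]_d -> K).

Lemma spanned_eq f g :
  (forall x, dot x x = 1 -> f x = g x) -> spanned e g -> spanned e f.
Proof. by move=> fg [c cE]; exists c => x x1; rewrite fg ?cE. Qed.

Lemma spannedD f g : spanned e f -> spanned e g ->
  spanned e (fun x => f x + g x).
Proof.
move=> [c cE] [b bE]; exists (fun j => c j + b j) => x x1.
by rewrite cE ?bE // -big_split; apply: eq_bigr => j _; rewrite mulrDl.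
Qed.

Lemma spannedZ a f : spanned e f -> spanned e (fun x => a * f x).
Proof.
move=> [c cE]; exists (fun j => a * c j) => x x1.
by rewrite cE // mulr_sumr; apply: eq_bigr => j _; rewrite mulrA.
Qed.

Lemma spanned0 : spanned e (fun=> 0).
Proof. by exists (fun=> 0) => x _; rewrite big1 // => j _; rewrite mul0r. Qed.

Lemma spanned_sum (T : finType) (a : T -> K) (h : T -> 'rV[K]_d -> K) :
  (forall t, spanned e (h t)) -> spanned e (fun x => \sum_t a t * h t x).
Proof.
move=> he.
elim: (index_enum T) => [|t r IH].
  by apply: spanned_eq spanned0 => x _; rewrite big_nil.
apply: (spanned_eq (g := fun x => a t * h t x + \sum_(t <- r) a t * h t x)).
  by move=> x _; rewrite big_cons.
exact: spannedD (spannedZ _ (he t)) IH.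
Qed.

End Spanned.

(** The functions [F i] are the Lagrange interpolation basis at the points
    [y i]: having as many of them as spanning functions, the two change of
    basis matrices are square, so one-sided inverses are two-sided. *)
Lemma interpolation (I J : finType) (e : J -> 'rV[K]_d -> K)
    (y : I -> 'rV[K]_d) (F : I -> 'rV[K]_d -> K) f :
  #|J| = #|I| -> (forall i, dot (y i) (y i) = 1) ->
  (forall i, spanned e (F i)) ->
  (forall i j, F i (y j) = (i == j)%:R) ->
  spanned e f ->
  forall x, dot x x = 1 -> f x = \sum_i f (y i) * F i x.
Proof.
move=> JI y1 Fe Fy [b bE] x x1.
have [c cE] : exists c : I -> J -> K,
    forall i x, dot x x = 1 -> F i x = \sum_j c i j * e j x.
  have : forall i, exists c : {ffun J -> K},
      forall x, dot x x = 1 -> F i x = \sum_j c j * e j x.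
    move=> i; have [c cE] := Fe i; exists (finfun c) => z z1.
    by rewrite cE //; apply: eq_bigr => j _; rewrite ffunE.
  by move=> /fin_all_exists [c cE]; exists c.
pose h (j : 'I_#|I|) : J := enum_val (cast_ord (esym JI) j).
have hbij : bijective h.
  exists (fun j => cast_ord JI (enum_rank j)) => j.
    by rewrite /h enum_valK cast_ordKV.
  by rewrite /h cast_ordK enum_rankK.
pose C := \matrix_(i < #|I|, j < #|I|) c (enum_val i) (h j).
pose V := \matrix_(j < #|I|, i < #|I|) e (h j) (y (enum_val i)).
have CV : C *m V = 1%:M.
  apply/matrixP => i j; rewrite !mxE.
  have := Fy (enum_val i) (enum_val j).
  rewrite cE // (inj_eq enum_val_inj) => <-.
  rewrite (reindex h) /=; last exact: onW_bij.
  by apply: eq_bigr => k _; rewrite !mxE.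
have /matrixP VC := mulmx1C CV.
(* The product of the two matrices in the other order expresses the spanning
   functions through their values at the points. *)
have eF j : e j x = \sum_i e j (y i) * F i x.
  have [g gK hK] := hbij.
  transitivity (\sum_k (V *m C) (g j) k * e (h k) x).
    under eq_bigr do rewrite VC mxE.
    rewrite (bigD1 (g j)) //= eqxx mul1r hK big1 ?addr0 // => k kj.
    by rewrite eq_sym (negbTE kj) mul0r.
  under eq_bigr do rewrite mxE mulr_suml.
  rewrite exchange_big [RHS](reindex (fun k : 'I_#|I| => enum_val k)) /=; last first.
    exact/onW_bij/enum_val_bij.
  apply: eq_bigr => i _; rewrite cE //.
  rewrite [in RHS](reindex h) /=; last exact: onW_bij.
  rewrite mulr_sumr; apply: eq_bigr => k _.
  by rewrite !mxE hK mulrA.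
rewrite bE //; under eq_bigr do rewrite eF mulr_sumr.
rewrite exchange_big /=; apply: eq_bigr => i _.
rewrite bE // mulr_suml; apply: eq_bigr => j _.
by rewrite mulrA.
Qed.

(** Sorted tuples of indices are canonical representatives of monomials. *)
Definition monomial_index n :=
  {t : n.-tuple 'I_d | sorted leq [seq val i | i <- t]}.

Definition mono n (t : monomial_index n) (x : 'rV[K]_d) : K :=
  \prod_(i <- val t) x 0 i.

Lemma mono_seq (s : seq 'I_d) :
  spanned (@mono (size s)) (fun x => \prod_(i <- s) x 0 i).
Proof.
pose r := sort (relpre val leq) s.
have rs : size r == size s by rewrite size_sort.
have sr : sorted leq [seq val i | i <- Tuple rs].
  by rewrite sorted_map /=; apply: sort_sorted => i j; apply: leq_total.
exists (fun t => (t == exist _ (Tuple rs) sr)%:R) => x _.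
rewrite (bigD1 (exist _ (Tuple rs) sr)) //= eqxx mul1r [X in _ + X]big1 => [|t tn].
  2: by rewrite (negbTE tn) mul0r.
by rewrite addr0; apply: perm_big; rewrite /= perm_sym perm_sort.
Qed.

Lemma mono_mul n f a : spanned (@mono n) f ->
  spanned (@mono n.+1) (fun x => f x * dot a x).
Proof.
move=> [c cE].
pose h (p : monomial_index n * 'I_d) (x : 'rV[K]_d) := mono p.1 x * x 0 p.2.
apply: (spanned_eq (g := fun x => \sum_p (c p.1 * a 0 p.2) * h p x)).
  move=> x x1; rewrite cE // mulr_suml.
  under eq_bigr do rewrite mulr_sumr.
  by rewrite pair_bigA /=; apply: eq_bigr => p _; rewrite /h; ring.
apply: spanned_sum => -[t i].
have := mono_seq (i :: val t).
rewrite /= size_tuple; apply: spanned_eq => x _.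
by rewrite /h big_cons mulrC.
Qed.

(** On the quadric [dot x x = 1], so a form may be multiplied by [dot x x]. *)
Lemma mono_up n f : spanned (@mono n) f -> spanned (@mono n.+2) f.
Proof.
move=> fn.
apply: (spanned_eq (g := fun x => \sum_i 1 * (f x * dot (delta_mx 0 i) x
                                           * dot (delta_mx 0 i) x))).
  move=> x x1; rewrite -[LHS]mulr1 -[X in _ * X = _]x1 {1}/dot mulr_sumr.
  by apply: eq_bigr => i _; rewrite mul1r dotC dot_delta mulrA.
by apply: spanned_sum => i; do 2!apply: mono_mul.
Qed.

Lemma mono0 : spanned (@mono 0) (fun=> 1).
Proof.
by have := mono_seq [::]; apply: spanned_eq => x _; rewrite big_nil.
Qed.

Lemma mono_opp n f x : spanned (@mono n) f ->
  dot x x = 1 -> f (- x) = (-1) ^+ n * f x.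
Proof.
move=> [c cE] x1; rewrite !cE ?dotNl ?dotNr ?opprK // mulr_sumr.
apply: eq_bigr => t _; rewrite mulrCA; congr (_ * _).
rewrite /mono; under eq_bigr do rewrite mxE -mulN1r.
by rewrite big_split /= big_const_seq count_predT size_tuple iter_mulr_1.
Qed.

(** Since a form of degree [n] is also one of degree [n + 2] on the quadric,
    two consecutive degrees account for all polynomials of degree at most
    [n + 1]. *)
Definition mono2 n (t : monomial_index n + monomial_index n.+1) x : K :=
  match t with inl t => mono t x | inr t => mono t x end.

Lemma mono2P n f : spanned (@mono2 n) f <->
  exists f1 f2, [/\ spanned (@mono n) f1, spanned (@mono n.+1) f2 &
    forall x, dot x x = 1 -> f x = f1 x + f2 x].
Proof.
split=> [[c cE]|[f1 [f2 [[c cE] [b bE] fE]]]].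
  exists (fun x => \sum_t c (inl t) * mono t x).
  exists (fun x => \sum_t c (inr t) * mono t x).
  split; [by eexists|by eexists|] => x x1.
  by rewrite cE // big_sumType.
exists (fun t => match t with inl t => c t | inr t => b t end) => x x1.
by rewrite fE // big_sumType /= cE ?bE.
Qed.

Lemma mono2_up n f : spanned (@mono2 n) f -> spanned (@mono2 n.+1) f.
Proof.
move=> /mono2P [f1 [f2 [s1 s2 fE]]]; apply/mono2P; exists f2, f1.
by split=> // [|x x1]; [apply: mono_up | rewrite addrC fE].
Qed.

Lemma mono2_mul n f a : spanned (@mono2 n) f ->
  spanned (@mono2 n.+1) (fun x => f x * dot a x).
Proof.
move=> /mono2P [f1 [f2 [s1 s2 fE]]]; apply/mono2P.
exists (fun x => f1 x * dot a x), (fun x => f2 x * dot a x).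
by split=> [||x x1]; [apply: mono_mul | apply: mono_mul | rewrite fE // mulrDl].
Qed.

Lemma mono2_affine n f a b : spanned (@mono2 n) f ->
  spanned (@mono2 n.+1) (fun x => f x * (dot a x - b)).
Proof.
move=> sf.
apply: (spanned_eq (g := fun x => f x * dot a x + (- b) * f x)).
  by move=> x _; ring.
by apply: spannedD; [apply: mono2_mul | apply: spannedZ; apply: mono2_up].
Qed.

Lemma mono2_prod n (s : seq ('rV[K]_d * K)) : (size s <= n.+1)%N ->
  spanned (@mono2 n) (fun x => \prod_(p <- s) (dot p.1 x - p.2)).
Proof.
have one : spanned (@mono2 0) (fun=> 1).
  apply/mono2P; exists (fun=> 1), (fun=> 0).
  by split; [exact: mono0 | exact: spanned0 | move=> x _; rewrite addr0].
elim: s n => [|p s IH] n sn.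
  elim: n {sn} => [|n IHn].
    by apply: spanned_eq one => x _; rewrite big_nil.
  by apply: spanned_eq (mono2_up IHn).
case: n sn => [|n] sn.
  case: s {IH} sn => //= _.
  apply/mono2P; exists (fun x => - p.2 * 1), (fun x => 1 * dot p.1 x).
  split; [apply: spannedZ mono0|apply: mono_mul mono0|] => x _.
  by rewrite big_seq1; ring.
apply: spanned_eq (mono2_affine p.1 p.2 (IH n sn)) => x _.
by rewrite big_cons mulrC.
Qed.

(** Of the two homogeneous components, parity kills the one of the wrong
    degree. *)
Lemma mono_parity n f : (2%:R != 0 :> K) -> spanned (@mono2 n) f ->
  (forall x, dot x x = 1 -> f (- x) = (-1) ^+ n * f x) -> spanned (@mono n) f.
Proof.
move=> K2 /mono2P [f1 [f2 [s1 s2 fE]]] fN; apply: (spanned_eq _ s1) => x x1.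
have := fN x x1; rewrite !fE // ?dotNl ?dotNr ?opprK //.
rewrite (mono_opp s1 x1) (mono_opp s2 x1) exprS.
have sgn : (-1) ^+ n != 0 :> K by rewrite signr_eq0.
move=> /eqP; rewrite -subr_eq0.
have -> : forall s a b : K, s * a + -1 * s * b - s * (a + b) = 2 * - (s * b).
  by move=> s a b; ring.
rewrite mulf_eq0 (negbTE K2) oppr_eq0 mulf_eq0 (negbTE sgn) /= => /eqP->.
by rewrite addr0.
Qed.

End PolynomialFunctions.

Lemma card_monomial_index d n : #|{: monomial_index d.+1 n}| = 'C(n + d, n).
Proof. by rewrite card_sig -card_sorted_tuples; apply: eq_card => t; rewrite !inE. Qed.

(** * Parts of top degree at isotropic vectors *)

Lemma poly_eq0_nat (K : numDomainType) (p : {poly K}) :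
  (forall n : nat, p.[n.+1%:R] = 0) -> p = 0.
Proof.
move=> p0; apply/eqP; apply: contraT => pn0.
pose rs := [seq n.+1%:R : K | n <- iota 0 (size p)].
suff : (size rs < size p)%N by rewrite size_map size_iota ltnn.
apply: max_poly_roots => //.
  by apply/allP => _ /mapP [n _ ->]; apply/rootP.
by rewrite map_inj_uniq ?iota_uniq // => m n /eqP; rewrite eqr_nat => /eqP [].
Qed.

Section Isotropic.
Variables (K : numFieldType) (d : nat).
Implicit Types (z x : 'rV[K]_d).

(** With such a partner the points [(s z' + s^-1 z) / 2] lie on the quadric
    [dot x x = 1] for all nonzero [s]. *)
Lemma isotropic_pair z : dot z z = 0 -> z != 0 ->
  exists z', dot z' z' = 0 /\ dot z z' = 2.
Proof.
move=> z0 zn0.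
have [i zi] : exists i, z 0 i != 0.
  by case/rV0Pn: zn0 => j zj; exists j.
(* Subtracting a multiple of [z] makes a basis vector isotropic without changing
   its product with [z]. *)
pose w := delta_mx 0 i - (2 * z 0 i)^-1 *: z.
have zw : dot z w = z 0 i by rewrite /w !dotE dot_delta z0; ring.
have ww : dot w w = 0.
  rewrite /w !dotE z0 (dotC _ z) !dot_delta mxE !eqxx /=.
  by field.
clearbody w; exists ((2 / z 0 i) *: w); split; rewrite !dotE ?ww ?zw; first by ring.
by field.
Qed.

(** A curve on the quadric going to infinity in the direction [z] sees only
    the parts of top degree. *)
Lemma top_form (I : finType) (w : I -> K) n
    (L : I -> seq ('rV[K]_d * K)) (L0 : seq ('rV[K]_d * K)) z :
  (forall i, size (L i) = n) -> size L0 = n ->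
  (forall x, dot x x = 1 ->
     \sum_i w i * \prod_(p <- L i) (dot p.1 x - p.2)
     = \prod_(p <- L0) (dot p.1 x - p.2)) ->
  dot z z = 0 -> z != 0 ->
  \sum_i w i * \prod_(p <- L i) dot p.1 z = \prod_(p <- L0) dot p.1 z.
Proof.
move=> sL sL0 LL0 z0 zn0.
have [z' [z'0 zz']] := isotropic_pair z0 zn0.
(* [G p] evaluates at [s] to [2 s] times the affine form [p] at the point [x s],
   and at [0] to the linear part of [p] at [z]. *)
pose G (p : 'rV[K]_d * K) : {poly K} :=
  (dot p.1 z')%:P * 'X^2 + (dot p.1 z)%:P - (2 * p.2)%:P * 'X.
pose x (s : K) := (2 * s)^-1 *: (s ^+ 2 *: z' + z).
have x1 s : s != 0 -> dot (x s) (x s) = 1.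
  by move=> sn0; rewrite /x !dotE z0 z'0 (dotC z' z) zz'; field.
have Gs s (l : seq ('rV[K]_d * K)) : s != 0 ->
    (\prod_(p <- l) G p).[s]
    = (2 * s) ^+ size l * \prod_(p <- l) (dot p.1 (x s) - p.2).
  move=> sn0; elim: l => [|p l IH]; first by rewrite !big_nil hornerC mulr1.
  rewrite !big_cons hornerM IH /= exprS.
  have -> : (G p).[s] = 2 * s * (dot p.1 (x s) - p.2).
    by rewrite /G /x !hornerE !dotE /=; field.
  by ring.
have G0 (l : seq ('rV[K]_d * K)) :
    (\prod_(p <- l) G p).[0] = \prod_(p <- l) dot p.1 z.
  elim: l => [|p l IH]; first by rewrite !big_nil hornerC.
  by rewrite !big_cons hornerM IH /G !hornerE /=; ring.
pose P := \sum_i (w i)%:P * (\prod_(p <- L i) G p) - \prod_(p <- L0) G p.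
have P0 : P = 0.
  apply: poly_eq0_nat => m.
  have sn0 : m.+1%:R != 0 :> K by rewrite pnatr_eq0.
  rewrite /P hornerD hornerN horner_sum Gs // sL0.
  under [X in X - _]eq_bigr do rewrite hornerM hornerC Gs // sL mulrCA.
  by rewrite -mulr_sumr LL0 ?subrr //; apply: x1.
have : P.[0] = 0 by rewrite P0 hornerC.
rewrite /P hornerD hornerN horner_sum G0.
under [X in X - _]eq_bigr do rewrite hornerM hornerC G0.
by move/eqP; rewrite subr_eq0 => /eqP.
Qed.

End Isotropic.

Lemma coef2_trinomial_exp (K : comNzRingType) (a b c : K) n :
  ((a%:P + b%:P * 'X + c%:P * 'X^2) ^+ n.+2)`_2
  = 'C(n.+2, 2)%:R * a ^+ n * b ^+ 2 + n.+2%:R * a ^+ n.+1 * c.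
Proof.
set p := _ + _.
have pS (q : {poly K}) i : (p * q)`_i = a * q`_i + b * (if i is j.+1 then q`_j else 0)
   + c * (if i is j.+2 then q`_j else 0).
  rewrite /p !mulrDl !coefD coefCM -!mulrA !coefCM !coefXM.
  by case: i => [|[|i]].
have c0 m : (p ^+ m)`_0 = a ^+ m.
  elim: m => [|m IH]; first by rewrite expr0 coefC.
  by rewrite exprS pS IH exprS; ring.
have c1 m : (p ^+ m.+1)`_1 = m.+1%:R * a ^+ m * b.
  elim: m => [|m IH]; first by rewrite expr1 /p !coefD !coefC !coefCM coefX coefXn /=; ring.
  by rewrite exprS pS IH c0 !exprS; ring.
elim: n => [|n IH].
  by rewrite exprS pS c1 c0 expr1 /p !coefD !coefC !coefCM coefX coefXn binn /=; ring.
have -> : 'C(n.+3, 2) = ('C(n.+2, 2) + n.+2)%N by rewrite binS bin1.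
by rewrite exprS pS IH c1 c0 natrD !exprS; ring.
Qed.

(** * Signed measures annihilating isotropic powers *)

Section Moments.
Variables (K : numClosedFieldType) (d : nat) (I : finType).
Variables (y : I -> 'rV[K]_d) (v : I -> K).
Hypothesis y1 : forall i, dot (y i) (y i) = 1.
Implicit Types (z a b p q : 'rV[K]_d).

(** In dimension at least 2, the powers [dot x z ^+ l] with [z] isotropic span the
    harmonic forms of degree [l], which the rotation invariant measure makes orthogonal to all polynomials
    of lower degree; the weighted points [y i] are asked for the same. *)
Definition kills_isotropic l := forall z (s : seq 'rV[K]_d),
  dot z z = 0 -> (size s < l)%N ->
  \sum_i v i * (dot (y i) z ^+ l * \prod_(a <- s) dot (y i) a) = 0.

(** The vectors [z + t b - (t ^+ 2 * dot b b / 4) z'] are isotropic for all [t];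
    the relation is the coefficient of [t ^+ 2]. *)
Lemma kills_isotropic_tangent l z z' b (s : seq 'rV[K]_d) :
  kills_isotropic l.+2 -> (size s < l.+2)%N ->
  dot z z = 0 -> dot z' z' = 0 -> dot z z' = 2 ->
  dot b z = 0 -> dot b z' = 0 ->
  \sum_i v i * ((2 * l.+1%:R * dot (y i) z ^+ l * dot (y i) b ^+ 2
      - dot b b * (dot (y i) z ^+ l.+1 * dot (y i) z'))
      * \prod_(a <- s) dot (y i) a) = 0.
Proof.
move=> kl sl z0 z'0 zz' bz bz'.
pose P : {poly K} := \sum_i (v i * \prod_(a <- s) dot (y i) a)%:P *
  ((dot (y i) z)%:P + (dot (y i) b)%:P * 'X
    + (- (dot b b / 4) * dot (y i) z')%:P * 'X^2) ^+ l.+2.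
have P0 : P = 0.
  apply: poly_eq0_nat => m; set t := m.+1%:R.
  pose zt := z + t *: b - (t ^+ 2 * dot b b / 4) *: z'.
  have zt0 : dot zt zt = 0.
    rewrite /zt !dotE z0 z'0 !(dotC _ b) bz bz' !(dotC z' z) zz'.
    by field.
  rewrite -[RHS](kl zt s zt0 sl) /P horner_sum; apply: eq_bigr => i _.
  rewrite hornerM hornerC horner_exp.
  set A := (_.[t]); have -> : A = dot (y i) zt.
    by rewrite /A /zt !hornerE !dotE /=; field.
  by ring.
have := congr1 (fun p : {poly K} => p`_2) P0.
rewrite coef0 /P coef_sum.
under eq_bigr do rewrite coefCM coef2_trinomial_exp.
have l2 : l.+2%:R != 0 :> K by rewrite pnatr_eq0.
move/(congr1 (fun x => 4 / l.+2%:R * x)); rewrite mulr0 => Q0.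
rewrite -[RHS]Q0 mulr_sumr; apply: eq_bigr => i _.
have -> : 'C(l.+2, 2)%:R = l.+2%:R * l.+1%:R / 2 :> K.
  apply: (canRL (mulfK _)); first by rewrite pnatr_eq0.
  by rewrite -!natrM mulnC -(mul_bin_diag l.+2 1) bin1.
by move: l.+2%:R l2 => N N0; field.
Qed.

(** The tangent relation is summed over the projections [b j] of the basis
    vectors to the complement of the plane of [z] and [z']: there
    [dot (y i) (b j) ^+ 2] adds up to [1 - dot (y i) z * dot (y i) z'], which
    trades a term with [dot (y i) z ^+ l] for terms with higher powers. Including
    [z] among the linear factors leaves [dot (y i) z ^+ l.+1] on one side and
    [dot (y i) z ^+ l.+2] on the other, and the latter sums to zero. *)
Lemma kills_isotropic_pred l :
  kills_isotropic l.+2 -> kills_isotropic l.+1.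
Proof.
move=> kl z s z0 sl.
have [->|zn0] := eqVneq z 0.
  by rewrite big1 // => i _; rewrite dot0r expr0n mul0r mulr0.
have [z' [z'0 zz']] := isotropic_pair z0 zn0.
pose b j := delta_mx 0 j - (z 0 j / 2) *: z' - (z' 0 j / 2) *: z.
have bz j : dot (b j) z = 0.
  by rewrite /b !dotE z0 (dotC z' z) zz' dotC dot_delta; field.
have bz' j : dot (b j) z' = 0.
  by rewrite /b !dotE z'0 zz' dotC dot_delta; field.
have bb j : dot (b j) (b j) = 1 - z 0 j * z' 0 j.
  rewrite /b !dotE z0 z'0 (dotC z' z) zz' !dot_delta (dotC _ z') (dotC _ z).
  rewrite !dot_delta mxE !eqxx /=.
  by field.
have sum_bb : \sum_j dot (b j) (b j) = d%:R - 2.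
  under eq_bigr do rewrite bb.
  by rewrite sumrB sumr_const card_ord -zz'.
have sum_yb i : \sum_j dot (y i) (b j) ^+ 2 = 1 - dot (y i) z * dot (y i) z'.
  pose w := y i - (dot (y i) z / 2) *: z' - (dot (y i) z' / 2) *: z.
  have yb j : dot (y i) (b j) = w 0 j.
    by rewrite /b !dotE dot_delta /w !mxE; ring.
  transitivity (dot w w); first by apply: eq_bigr => j _; rewrite yb expr2.
  rewrite /w !dotE y1 z0 z'0 (dotC z' z) zz' !(dotC _ (y i)).
  by field.
have key := kills_isotropic_tangent (s := z :: s) kl sl z0 z'0 zz'.
have : \sum_j \sum_i v i * ((2 * l.+1%:R * dot (y i) z ^+ l * dot (y i) (b j) ^+ 2
      - dot (b j) (b j) * (dot (y i) z ^+ l.+1 * dot (y i) z'))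
      * \prod_(a <- z :: s) dot (y i) a) = 0.
  by rewrite big1 // => j _; apply: key.
rewrite exchange_big /=.
have -> : \sum_i \sum_j v i * ((2 * l.+1%:R * dot (y i) z ^+ l * dot (y i) (b j) ^+ 2
      - dot (b j) (b j) * (dot (y i) z ^+ l.+1 * dot (y i) z'))
      * \prod_(a <- z :: s) dot (y i) a)
  = 2 * l.+1%:R * (\sum_i v i * (dot (y i) z ^+ l.+1 * \prod_(a <- s) dot (y i) a))
  - (2 * l.+1%:R + (d%:R - 2)) *
    (\sum_i v i * (dot (y i) z ^+ l.+2 * \prod_(a <- z' :: s) dot (y i) a)).
  rewrite !mulr_sumr -sumrB; apply: eq_bigr => i _.
  rewrite -mulr_sumr -mulr_suml sumrB -mulr_sumr -mulr_suml sum_yb sum_bb.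
  by rewrite !big_cons !exprS; ring.
rewrite (kl z (z' :: s)) // mulr0 subr0 => /eqP.
by rewrite !mulf_eq0 !pnatr_eq0 /= => /eqP.
Qed.

(* The identity obtained by comparing parts of top degree in an interpolation
   formula with nodes [y i]. *)
Variable n : nat.
Hypothesis top : forall z (s : seq 'rV[K]_d),
  dot z z = 0 -> z != 0 -> (size s <= n)%N ->
  \sum_i v i * (dot (y i) z ^+ n * \prod_(a <- s) dot (y i) a)
  = if size s == n then \prod_(a <- s) dot z a else 0.

Lemma kills_isotropic_le l : (0 < l <= n)%N -> kills_isotropic l.
Proof.
have kn : (0 < n)%N -> kills_isotropic n.
  move=> n0 z s z0 sn; have [->|zn0] := eqVneq z 0.
    by rewrite big1 // => i _; rewrite dot0r expr0n gtn_eqF // mul0r mulr0.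
  by have := top z0 zn0 (ltnW sn); rewrite (ltn_eqF sn).
move=> /andP [l0 ln].
have -> : l = (n - (n - l))%N by rewrite subKn.
have : (n - l < n)%N by lia.
move: (n - l)%N => m {l l0 ln}; elim: m => [|m IH] mn; first by rewrite subn0; apply: kn.
have -> : (n - m.+1 = (n - m).-2.+1)%N by lia.
apply: kills_isotropic_pred.
have -> : ((n - m).-2.+2 = n - m)%N by lia.
by apply: IH; lia.
Qed.

(** If [i] exceeds [n], the extra powers of [p] are moved among the linear
    factors, where the top degree identity produces the factor [dot p p = 0]. *)
Lemma mixed_isotropic_lt p q i j : dot p p = 0 -> dot q q = 0 ->
  (j < i)%N -> (i + j <= n.*2)%N ->
  \sum_t v t * (dot (y t) p ^+ i * dot (y t) q ^+ j) = 0.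
Proof.
move=> p0 q0 ji ijn.
have prodn (t : 'rV[K]_d) a m : \prod_(b <- nseq m a) dot t b = dot t a ^+ m.
  by rewrite big_nseq iter_mulr_1.
have [il|nl] := leqP i n.
  have := @kills_isotropic_le i _ p (nseq j q) p0.
  rewrite size_nseq => /(_ _ ji) H; rewrite -[RHS]H; last by lia.
  by apply: eq_bigr => t _; rewrite prodn.
have [->|pn0] := eqVneq p 0.
  by rewrite big1 // => t _; rewrite dot0r expr0n gtn_eqF ?mul0r ?mulr0 //; lia.
have := @top p (nseq (i - n) p ++ nseq j q) p0 pn0.
rewrite size_cat !size_nseq => /(_ ltac:(lia)) H.
transitivity (\sum_t v t * (dot (y t) p ^+ n *
   \prod_(a <- nseq (i - n) p ++ nseq j q) dot (y t) a)).
  apply: eq_bigr => t _; rewrite big_cat /= !prodn mulrA -exprD.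
  by rewrite subnKC // ltnW.
rewrite H big_cat /= !prodn p0 expr0n.
by rewrite subn_eq0 leqNgt nl mul0r if_same.
Qed.

Lemma mixed_isotropic p q i j : dot p p = 0 -> dot q q = 0 ->
  i != j -> (i + j <= n.*2)%N ->
  \sum_t v t * (dot (y t) p ^+ i * dot (y t) q ^+ j) = 0.
Proof.
move=> p0 q0; rewrite neq_ltn => /orP [ij|ji] ijn.
  under eq_bigr do rewrite [X in _ * X]mulrC.
  by apply: mixed_isotropic_lt => //; rewrite addnC.
exact: mixed_isotropic_lt.
Qed.

(** In the plane of [a] and [b] there are two isotropic directions [p] and [q],
    and up to a common factor [a] and [b] are the combinations of [p] and [q] with
    coefficients [1, -1] and [s^-1, -s]: the products of the two coefficients coincide, and the mixed
    moments of [p] and [q] vanish unless both exponents are equal. *)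
Lemma moment_eq a b m : (m <= n.*2)%N -> dot a a = dot b b ->
  dot a a != 0 -> dot a b != dot a a -> dot a b != - dot a a ->
  \sum_t v t * dot (y t) a ^+ m = \sum_t v t * dot (y t) b ^+ m.
Proof.
move=> mn ab r0 c1 cN1.
set r := dot a a in ab r0 c1 cN1; set c := dot a b in c1 cN1.
(* [s] is a root of [s ^+ 2 - 2 (c / r) s + 1], the condition for [b - s *: a]
   to be isotropic; the other root is its inverse. *)
pose e := sqrtC ((c / r) ^+ 2 - 1).
have e2 : e ^+ 2 = (c / r) ^+ 2 - 1 by rewrite sqrtCK.
pose s := c / r + e.
have s2 : s ^+ 2 * r = 2 * s * c - r.
  have -> : s ^+ 2 = 2 * s * (c / r) - (c / r) ^+ 2 + e ^+ 2 by rewrite /s; ring.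
  by rewrite e2; field.
have s0 : s != 0.
  apply/eqP => s0; move: s2; rewrite s0 expr0n mul0r mulr0 mul0r sub0r => /eqP.
  by rewrite eq_sym oppr_eq0 (negbTE r0).
have e0 : e != 0.
  rewrite -sqrf_eq0 e2 subr_eq0 sqrf_eq1 negb_or; apply/andP; split.
    by apply: contra_neq c1 => /(canRL (divfK r0)) ->; rewrite mul1r.
  by apply: contra_neq cN1 => /(canRL (divfK r0)) ->; rewrite mulN1r.
have dlt : s^-1 - s = - (2 * e).
  apply: (mulfI s0); rewrite mulrBr mulfV // -expr2.
  have sq : s ^+ 2 = 2 * s * (c / r) - 1.
    by apply: (mulIf r0); rewrite s2; field.
  have -> : e = s - c / r by rewrite /s; ring.
  apply/eqP; rewrite -subr_eq0.
  have -> : 1 - s ^+ 2 - s * - (2 * (s - c / r)) = s ^+ 2 - (2 * s * (c / r) - 1).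
    by ring.
  by rewrite sq subrr.
have d0 : s^-1 - s != 0 by rewrite dlt oppr_eq0 mulf_neq0 // pnatr_eq0.
pose p := b - s *: a; pose q := b - s^-1 *: a.
have p0 : dot p p = 0.
  rewrite /p !dotE -ab -/r !(dotC b a) -/c.
  transitivity (r - 2 * s * c + s ^+ 2 * r); first by ring.
  by rewrite s2; ring.
have q0 : dot q q = 0.
  rewrite /q !dotE -ab -/r !(dotC b a) -/c.
  transitivity (s ^- 2 * (s ^+ 2 * r - 2 * s * c + r)); first by field.
  by rewrite s2; ring.
have ap t : dot (y t) a = (s^-1 - s)^-1 * (dot (y t) p - dot (y t) q).
  by apply: (mulfI d0); rewrite mulrA mulfV // mul1r /p /q !dotE; field.
have bp t : dot (y t) b = (s^-1 - s)^-1 * (s^-1 * dot (y t) p - s * dot (y t) q).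
  by apply: (mulfI d0); rewrite mulrA mulfV // mul1r /p /q !dotE; field.
have binom (al be : K) : \sum_t v t * (al * dot (y t) p - be * dot (y t) q) ^+ m
   = \sum_(i < m.+1) al ^+ (m - i) * (- be) ^+ i *+ 'C(m, i) *
       \sum_t v t * (dot (y t) p ^+ (m - i) * dot (y t) q ^+ i).
  under eq_bigr => t _.
    rewrite -mulNr exprDn mulr_sumr.
    over.
  rewrite exchange_big /=; apply: eq_bigr => i _.
  rewrite mulr_sumr; apply: eq_bigr => t _.
  by rewrite !exprMn; ring.
under eq_bigr do rewrite ap exprMn mulrCA.
rewrite -mulr_sumr; under [RHS]eq_bigr do rewrite bp exprMn mulrCA.
rewrite -mulr_sumr; congr (_ * _).
under eq_bigr do rewrite -[dot _ p]mul1r -[dot _ q]mul1r.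
rewrite !binom; apply: eq_bigr => i _.
have [mi|mi] := eqVneq (m - i)%N i; last first.
  by rewrite mixed_isotropic // ?mulr0 //; have := ltn_ord i; lia.
by rewrite mi -!exprMn mul1r mulrN mulVf.
Qed.

End Moments.

(** * Real vectors *)

Section RealVectors.
Variables (R : realFieldType) (d : nat).
Implicit Types (a b x y : 'rV[R]_d).

Lemma dot_ge0 a : 0 <= dot a a.
Proof. by apply: sumr_ge0 => i _; rewrite -expr2 sqr_ge0. Qed.

Lemma dot_eq0 a : (dot a a == 0) = (a == 0).
Proof.
apply/eqP/eqP => [a0|->]; last exact: dot0l.
apply/rowP => i; rewrite mxE; apply/eqP; rewrite -sqrf_eq0.
apply/eqP; move: i isT; apply: psumr_eq0P => [i _|]; first exact: sqr_ge0.
by rewrite -[RHS]a0; apply: eq_bigr => i _; rewrite expr2.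
Qed.

Lemma dot_unit_eq1 x y : dot x x = 1 -> dot y y = 1 -> (dot x y == 1) = (x == y).
Proof.
move=> x1 y1; rewrite -[RHS]subr_eq0 -dot_eq0 !dotE x1 y1 (dotC y x).
by apply/eqP/eqP => h; lra.
Qed.

Lemma dot_unit_eqN1 x y :
  dot x x = 1 -> dot y y = 1 -> (dot x y == -1) = (x == - y).
Proof.
move=> x1 y1; rewrite -dot_unit_eq1 ?dotNr ?dotNl ?opprK //.
by rewrite eqr_oppLR.
Qed.

Lemma orthogonal_vector x : (1 < d)%N -> exists2 u, dot x u = 0 & u != 0.
Proof.
case: d x => [|[|e]] // x _.
pose i0 : 'I_e.+2 := 0; pose i1 : 'I_e.+2 := 1.
pose u : 'rV[R]_e.+2 := x 0 i1 *: delta_mx 0 i0 - x 0 i0 *: delta_mx 0 i1.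
have [u0|un0] := eqVneq u 0.
  have := congr1 (fun m : 'rV_e.+2 => m 0 i1) u0.
  rewrite !mxE !eqxx /= mulr0 sub0r mulr1 => /eqP; rewrite oppr_eq0 => /eqP x0.
  exists (delta_mx 0 i0); first by rewrite dot_delta.
  apply/eqP => /(congr1 (fun m : 'rV_e.+2 => m 0 i0)).
  by rewrite !mxE !eqxx /= => /eqP; rewrite oner_eq0.
exists u => //; rewrite /u !dotE !dot_delta; ring.
Qed.

End RealVectors.

(** * Moments and reproducing polynomials over the reals *)

Section Complexification.
Variables (R : rcfType) (d : nat).

Definition cplx (a : 'rV[R]_d) : 'rV[R[i]]_d := map_mx (real_complex R) a.

Lemma dot_cplx a b : dot (cplx a) (cplx b) = (dot a b)%:C%C.
Proof.
rewrite /dot (rmorph_sum (real_complex R)) /=.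
by apply: eq_bigr => i _; rewrite !mxE rmorphM.
Qed.

Variables (I : finType) (x : I -> 'rV[R]_d) (v : I -> R) (n : nat).
Hypothesis x1 : forall i, dot (x i) (x i) = 1.
Hypothesis top : forall z (s : seq 'rV[R[i]]_d),
  dot z z = 0 -> z != 0 -> (size s <= n)%N ->
  \sum_i (v i)%:C%C * (dot (cplx (x i)) z ^+ n * \prod_(a <- s) dot (cplx (x i)) a)
  = if size s == n then \prod_(a <- s) dot z a else 0.

(** For real vectors of the same length, [dot a b = dot a a] forces [a = b] and
    [dot a b = - dot a a] forces [a = - b]. *)
Lemma real_moment_eq a b m : (m <= n.*2)%N -> dot a a = dot b b -> a + b != 0 ->
  \sum_i v i * dot (x i) a ^+ m = \sum_i v i * dot (x i) b ^+ m.
Proof.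
move=> mn ab aNb.
have [->//|anb] := eqVneq a b.
apply: (@complexI R); rewrite !rmorph_sum /=.
have E c : \sum_i (v i * dot (x i) c ^+ m)%:C%C
   = \sum_i (v i)%:C%C * dot (cplx (x i)) (cplx c) ^+ m.
  by apply: eq_bigr => i _; rewrite dot_cplx rmorphM rmorphXn.
rewrite !E.
have y1 i : dot (cplx (x i)) (cplx (x i)) = 1 by rewrite dot_cplx x1.
apply: (moment_eq y1 top mn); rewrite !dot_cplx ?ab //.
- rewrite (inj_eq (@complexI R)) -ab dot_eq0; apply: contraNneq anb => a0.
  by move: ab; rewrite a0 dot0l => /esym/eqP; rewrite dot_eq0 => /eqP->.
- rewrite (inj_eq (@complexI R)) -ab; apply: contra anb => /eqP h.
  by rewrite -subr_eq0 -dot_eq0 !dotE (dotC b a) -ab h; apply/eqP; ring.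
- rewrite -rmorphN (inj_eq (@complexI R)) -ab; apply: contra aNb => /eqP h.
  by rewrite -dot_eq0 !dotE (dotC b a) -ab h; apply/eqP; ring.
Qed.

(** Polarization: the vectors [t a1 + a2] and [t b1 + b2] have the same length for
    all [t], hence equal moments, and the coefficients of the powers of [t] agree.
    The factor [L] vanishes at the exceptional values of [t] at which the two
    vectors are opposite. *)
Lemma pair_moment_eq a1 a2 b1 b2 i j : (i + j <= n.*2)%N ->
  dot a1 a1 = dot b1 b1 -> dot a2 a2 = dot b2 b2 -> dot a1 a2 = dot b1 b2 ->
  a2 + b2 != 0 ->
  \sum_t v t * (dot (x t) a1 ^+ i * dot (x t) a2 ^+ j)
  = \sum_t v t * (dot (x t) b1 ^+ i * dot (x t) b2 ^+ j).
Proof.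
move=> ijn e11 e22 e12 /rV0Pn [c cn0].
pose P a1 a2 : {poly R} :=
  \sum_t (v t)%:P * ((dot (x t) a2)%:P + (dot (x t) a1)%:P * 'X) ^+ (i + j).
have PE (a b : 'rV[R]_d) s : (P a b).[s] = \sum_t v t * dot (x t) (s *: a + b) ^+ (i + j).
  rewrite horner_sum; apply: eq_bigr => t _.
  by rewrite !hornerE /= !dotE addrC mulrC [s * _]mulrC mulrC.
pose L : {poly R} := ((a2 + b2) 0 c)%:P + ((a1 + b1) 0 c)%:P * 'X.
have L0 : L != 0.
  apply: contraNneq cn0 => L0; have : L.[0] = 0 by rewrite L0 hornerC.
  by rewrite /L !hornerE => ->.
have : (P a1 a2 - P b1 b2) * L = 0.
  apply: poly_eq0_nat => m; rewrite hornerM.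
  have [->|Ln0] := eqVneq L.[m.+1%:R] 0; first by rewrite mulr0.
  rewrite hornerD hornerN !PE (@real_moment_eq _ (m.+1%:R *: b1 + b2)) //.
  - by rewrite subrr mul0r.
  - by rewrite !dotE (dotC a2 a1) (dotC b2 b1) e11 e12 e22; ring.
  apply: contraNneq Ln0 => h.
  move/rowP/(_ c): h; rewrite !mxE /= => <-; rewrite /L !hornerE !mxE /=.
  by apply/eqP; ring.
move/eqP; rewrite mulf_eq0 (negbTE L0) orbF subr_eq0 => /eqP.
have coefP a b : (P a b)`_i = 'C(i + j, i)%:R *
    \sum_t v t * (dot (x t) a ^+ i * dot (x t) b ^+ j).
  rewrite coef_sum mulr_sumr; apply: eq_bigr => t _.
  rewrite coefCM exprDn coef_sum.
  have li : (i < (i + j).+1)%N by lia.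
  rewrite (bigD1 (Ordinal li)) //= [X in _ + X]big1 => [|l li'].
    rewrite addr0 exprMn -!rmorphXn /= mulrA -rmorphM /= -mulr_natl mulrA.
    rewrite -polyCMn -rmorphM /= ?coefCM coefXn eqxx addKn.
    by rewrite mulr1; ring.
  rewrite exprMn -!rmorphXn /= mulrA -rmorphM /= coefMn coefCM coefXn.
  have /negbTE -> : i != l by apply: contraNneq li' => h; apply/eqP/val_inj.
  by rewrite mulr0 mul0rn.
move/(congr1 (fun p : {poly R} => p`_i)); rewrite !coefP; apply: mulfI.
by rewrite pnatr_eq0 -lt0n bin_gt0 leq_addr.
Qed.

Lemma pair_poly_eq a1 a2 b1 b2 (f g : {poly R}) :
  (size f <= n.+1)%N -> (size g <= n.+1)%N ->
  dot a1 a1 = dot b1 b1 -> dot a2 a2 = dot b2 b2 -> dot a1 a2 = dot b1 b2 ->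
  a2 + b2 != 0 ->
  \sum_t v t * (f.[dot (x t) a1] * g.[dot (x t) a2])
  = \sum_t v t * (f.[dot (x t) b1] * g.[dot (x t) b2]).
Proof.
move=> sf sg e11 e22 e12 ab.
have E (a b : 'rV[R]_d) : \sum_t v t * (f.[dot (x t) a] * g.[dot (x t) b])
   = \sum_(i < n.+1) \sum_(j < n.+1) f`_i * g`_j *
       \sum_t v t * (dot (x t) a ^+ i * dot (x t) b ^+ j).
  under eq_bigr => t _ do rewrite (horner_coef_wide _ sf) (horner_coef_wide _ sg)
     big_distrlr mulr_sumr.
  rewrite exchange_big; apply: eq_bigr => i _ /=.
  under eq_bigr do rewrite mulr_sumr.
  rewrite exchange_big; apply: eq_bigr => j _ /=.
  by rewrite mulr_sumr; apply: eq_bigr => t _; ring.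
rewrite !E; apply: eq_bigr => i _; apply: eq_bigr => j _; congr (_ * _).
by apply: pair_moment_eq => //; have := ltn_ord i; have := ltn_ord j; lia.
Qed.

(** The reflection exchanging [b] and [x i] sends [x j] to a vector [x'] such that
    the pairs [x j, b] and [x', x i] have the same Gram matrix. The pairing of
    [M j] and [M i] at the first pair is evaluated by the reproducing property of
    [M j], at the second pair by that of [M i]. *)
Lemma node_polys_agree (M : I -> {poly R}) :
  (forall i, (size (M i) <= n.+1)%N) ->
  (forall i j b, \sum_t v t * ((M i).[dot (x t) (x i)] * (M j).[dot (x t) b])
                 = (M j).[dot (x i) b]) ->
  forall i j b, dot b b = 1 -> b + x i != 0 ->
  (M i).[dot (x j) b] = (M j).[dot (x j) b].
Proof.
move=> sM rep i j b b1 bi.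
pose w := x i - b.
pose x' := x j - (2 * dot (x j) w / dot w w) *: w.
have [x'1 x'i] : dot x' x' = 1 /\ dot x' (x i) = dot (x j) b.
  have [w0|wn0] := eqVneq w 0.
    rewrite /x' w0 scaler0 subr0 x1; split=> //; congr (dot _ _).
    by apply/eqP; rewrite -subr_eq0 -/w w0.
  have ww : dot w w != 0 by rewrite dot_eq0.
  have wi : dot w (x i) = dot w w / 2.
    by rewrite /w !dotE x1 b1 (dotC b (x i)); field.
  have wE : w = x i - b by [].
  clearbody w; rewrite /x' !dotE wi (dotC w (x j)) x1; split; first by field.
  transitivity (dot (x j) (x i) - dot (x j) w); first by field.
  by rewrite wE !dotE; ring.
rewrite -rep (@pair_poly_eq (x j) b x' (x i)) ?x1 ?x'1 ?x'i //.
under eq_bigr do rewrite [X in _ * X]mulrC.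
by rewrite rep dotC x'i.
Qed.

End Complexification.

(** * Consequences of taking parts of top degree *)

Section TopDegree.
Variables (K : numClosedFieldType) (d : nat).

(** If [s] has fewer than [n] elements, the right hand side of the interpolation
    identity has no part of degree [n]. *)
Lemma top_of_interpolation (I : finType) (y : I -> 'rV[K]_d) (v : I -> K)
    (A : I -> seq K) n (s : seq 'rV[K]_d) z :
  (forall i, size (A i) = n) -> (size s <= n)%N ->
  (forall x, dot x x = 1 ->
    \sum_i v i * \prod_(a <- s) dot (y i) a * \prod_(c <- A i) (dot (y i) x - c)
    = \prod_(a <- s) dot x a) ->
  dot z z = 0 -> z != 0 ->
  \sum_i v i * (dot (y i) z ^+ n * \prod_(a <- s) dot (y i) a)
  = if size s == n then \prod_(a <- s) dot z a else 0.
Proof.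
move=> sA sn interp z0 zn0.
(* A zero vector shifted by -1 is the constant affine form 1, whose linear part
   vanishes. *)
pose L0 : seq ('rV[K]_d * K) := [seq (a, 0) | a <- s] ++ nseq (n - size s) (0, -1).
pose L i := [seq (y i, c) | c <- A i].
have := @top_form K d I (fun i => v i * \prod_(a <- s) dot (y i) a) n L L0 z.
have sL0 : size L0 = n by rewrite size_cat size_map size_nseq subnKC.
move=> /(_ (fun i => etrans (size_map _ _) (sA i)) sL0) H.
transitivity (\sum_i v i * \prod_(a <- s) dot (y i) a * \prod_(p <- L i) dot p.1 z).
  apply: eq_bigr => i _; rewrite /L big_map /= big_const_seq count_predT iter_mulr_1.
  by rewrite sA; ring.
rewrite H {H}//.
  rewrite /L0 big_cat /= big_map big_nseq iter_mulr_1 dot0l expr0n subn_eq0.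
  have -> : (n <= size s)%N = (size s == n) by rewrite eqn_leq sn.
  by case: eqP => _; rewrite ?mulr1 ?mulr0 //; apply: eq_bigr => a _; rewrite dotC.
move=> x x1.
rewrite (eq_bigr (fun i => v i * \prod_(a <- s) dot (y i) a
    * \prod_(c <- A i) (dot (y i) x - c))) => [|i _]; last by rewrite big_map.
rewrite interp // /L0 big_cat /= big_map big_nseq iter_mulr_1 dot0l sub0r opprK expr1n mulr1.
by apply: eq_bigr => a _; rewrite subr0 dotC.
Qed.

(** At the isotropic vector [y + c u] with [c ^+ 2 = - 1 / dot u u], the top
    part is [c * dot u u]. *)
Lemma vanishing_absurd (y u : 'rV[K]_d) (s : seq K) :
  dot y y = 1 -> dot y u = 0 -> dot u u != 0 ->
  ~ (forall x, dot x x = 1 -> \prod_(c <- s) (dot y x - c) * dot u x = 0).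
Proof.
move=> y1 yu u0 H.
pose c := sqrtC (- (dot u u)^-1).
have c2 : c ^+ 2 = - (dot u u)^-1 by rewrite sqrtCK.
have c0 : c != 0 by rewrite -sqrf_eq0 c2 oppr_eq0 invr_eq0.
pose z := y + c *: u.
have yz : dot y z = 1 by rewrite /z !dotE y1 yu; ring.
have uz : dot u z = c * dot u u by rewrite /z !dotE dotC yu; ring.
have z0 : dot z z = 0.
  have -> : dot z z = dot y z + c * dot u z by rewrite {1}/z dotDl dotZl.
  by rewrite yz uz mulrA -expr2 c2; field.
have zn0 : z != 0 by apply: contra_neq (oner_neq0 K) => h; rewrite -yz h dot0r.
pose L0 := (u, 0) :: [seq (y, c) | c <- s].
have := @top_form K d 'I_0 (fun=> 0) (size s).+1 (fun=> L0) L0 z.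
rewrite /= size_map => /(_ (fun=> erefl) erefl) /= T.
have /esym/eqP : \sum_(i < 0) 0 * \prod_(p <- L0) dot p.1 z
    = \prod_(p <- L0) dot p.1 z.
  apply: T => // x x1; rewrite big_ord0 /L0 big_cons big_map /= subr0 mulrC.
  by rewrite H.
rewrite big_ord0 /L0 big_cons big_map /= uz yz.
by rewrite big_const_seq count_predT iter_mulr_1 expr1n mulr1 mulf_eq0 (negbTE c0) (negbTE u0).
Qed.

End TopDegree.

(** * Lagrange functions attached to the points *)

Section Lagrange.
Variables (R : rcfType) (d n : nat) (I : finType).
Variables (x : I -> 'rV[R]_d) (G : I -> seq R).
Hypothesis x1 : forall i, dot (x i) (x i) = 1.
Hypothesis sG : forall i, (size (G i) <= n)%N.
Hypothesis G1 : forall i, 1 \notin G i.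

(** Padding with the root [0] keeps [1] out of the list and keeps a list that is
    symmetric under negation symmetric. *)
Definition pad m (s : seq R) := s ++ nseq (m - size s) 0.

Lemma size_pad m s : (size s <= m)%N -> size (pad m s) = m.
Proof. by move=> sm; rewrite size_cat size_nseq subnKC. Qed.

Definition node_poly i : {poly R} := \prod_(c <- pad n (G i)) ('X - c%:P).

Lemma size_node_poly i : size (node_poly i) = n.+1.
Proof. by rewrite size_prod_XsubC size_pad. Qed.

Lemma node_poly_root i c : c \in G i -> (node_poly i).[c] = 0.
Proof. by move=> ci; apply/rootP; rewrite /node_poly root_prod_XsubC mem_cat ci. Qed.

Lemma mem_of_root_node_poly i c : size (G i) = n -> (node_poly i).[c] = 0 -> c \in G i.
Proof. by move=> si /rootP; rewrite /node_poly root_prod_XsubC /pad si subnn cats0. Qed.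

Lemma node_poly1_neq0 i : (node_poly i).[1] != 0.
Proof.
apply/negP => /eqP/rootP; rewrite /node_poly root_prod_XsubC mem_cat (negbTE (G1 i)) /=.
by rewrite mem_nseq oner_eq0 andbF.
Qed.

Definition node_weight i : R := (node_poly i).[1]^-1.

Definition affine_prod (a : 'rV[R]_d) (s : seq R) (z : 'rV[R[i]]_d) : R[i] :=
  \prod_(c <- s) (dot (cplx a) z - c%:C%C).

Lemma affine_prod_cplx a s b :
  affine_prod a s (cplx b) = (\prod_(c <- s) ('X - c%:P)).[dot a b]%:C%C.
Proof.
rewrite horner_prod rmorph_prod; apply: eq_bigr => c _ /=.
by rewrite dot_cplx hornerXsubC rmorphB.
Qed.

Definition lagrange i z := (node_weight i)%:C%C * affine_prod (x i) (pad n (G i)) z.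

Lemma lagrange_cplx i b :
  lagrange i (cplx b) = (node_weight i * (node_poly i).[dot (x i) b])%:C%C.
Proof. by rewrite /lagrange affine_prod_cplx -rmorphM. Qed.

Hypothesis Groot : forall i j, i != j -> dot (x i) (x j) \in G i.
Variables (J : finType) (e : J -> 'rV[R[i]]_d -> R[i]).
Hypothesis cardJ : #|J| = #|I|.
Hypothesis span_lagrange : forall i, spanned e (lagrange i).

Lemma lagrange_delta i j : lagrange i (cplx (x j)) = (i == j)%:R.
Proof.
rewrite lagrange_cplx; have [->|ij] := eqVneq i j.
  by rewrite x1 mulVf ?node_poly1_neq0.
by rewrite node_poly_root ?Groot // mulr0.
Qed.

Lemma lagrange_interpolation f : spanned e f ->
  forall z, dot z z = 1 -> f z = \sum_i f (cplx (x i)) * lagrange i z.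
Proof.
apply: (@interpolation _ _ I J e (fun i => cplx (x i)) lagrange f) => //.
  by move=> i; rewrite dot_cplx x1.
exact: lagrange_delta.
Qed.

(** With fewer than [n] roots there is room for a linear factor [dot u z] which
    vanishes at [x i] itself; the product then vanishes at all interpolation
    nodes, hence on the whole quadric. *)
Lemma size_roots_eq i : (1 < d)%N ->
  (forall u, (size (G i) < n)%N ->
    spanned e (fun z => affine_prod (x i) (pad n.-1 (G i)) z * dot (cplx u) z)) ->
  size (G i) = n.
Proof.
move=> d1 spanu; apply/eqP; rewrite eqn_leq sG /=; rewrite leqNgt; apply/negP => sn.
have [u xu un0] := orthogonal_vector (x i) d1.
apply: (@vanishing_absurd R[i] d (cplx (x i)) (cplx u)
  [seq c%:C%C | c <- pad n.-1 (G i)]).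
- by rewrite dot_cplx x1.
- by rewrite dot_cplx xu.
- by rewrite dot_cplx (inj_eq (@complexI R)) dot_eq0.
move=> z z1; rewrite big_map.
have /= := lagrange_interpolation (spanu u sn) z1; rewrite /affine_prod => ->.
rewrite big1 // => j _; rewrite -/(affine_prod (x i) _ _) affine_prod_cplx dot_cplx.
have [<-|ij] := eqVneq i j; first by rewrite (dotC u) xu mulr0 mul0r.
rewrite (_ : _.[_] = 0) ?mul0r //.
 apply/rootP.
by rewrite root_prod_XsubC mem_cat Groot.
Qed.

End Lagrange.

Lemma affine_prod_mono2 (R : rcfType) d (a : 'rV[R]_d) s n : (size s <= n.+1)%N ->
  spanned (@mono2 _ d n) (affine_prod a s).
Proof.
move=> sn.
have := @mono2_prod R[i] d n [seq (cplx a, c%:C%C) | c <- s].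
rewrite size_map => /(_ sn); apply: spanned_eq => z _.
by rewrite big_map.
Qed.

Lemma affine_prod_dot_mono2 (R : rcfType) d (a u : 'rV[R]_d) s n :
  (size s <= n)%N ->
  spanned (@mono2 _ d n) (fun z => affine_prod a s z * dot (cplx u) z).
Proof.
move=> sn.
have := @mono2_prod R[i] d n ((cplx u, 0) :: [seq (cplx a, c%:C%C) | c <- s]).
rewrite /= size_map => /(_ sn); apply: spanned_eq => z _.
by rewrite big_cons big_map /= subr0 mulrC.
Qed.

Lemma dot_prod_mono2 (K : fieldType) d (s : seq 'rV[K]_d) n : (size s <= n.+1)%N ->
  spanned (@mono2 _ d n) (fun z => \prod_(a <- s) dot z a).
Proof.
move=> sn; have := @mono2_prod K d n [seq (a, 0) | a <- s].
rewrite size_map => /(_ sn); apply: spanned_eq => z _.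
by rewrite big_map; apply: eq_bigr => a _; rewrite subr0 dotC.
Qed.

Lemma prodrZ_seq (K : comPzRingType) (T : Type) (s : seq T) (F : T -> K) c :
  \prod_(a <- s) (c * F a) = c ^+ size s * \prod_(a <- s) F a.
Proof. by rewrite big_split /= big_const_seq count_predT iter_mulr_1. Qed.

(** * Point sets attaining the bound *)

Section Tight.
Variables (R : rcfType) (d k : nat) (I : finType) (x : I -> 'rV[R]_d.+1).
Hypothesis x1 : forall i, dot (x i) (x i) = 1.
Hypothesis x_inj : injective x.

Definition inner_products i : seq R :=
  undup [seq dot (x i) (x j) | j <- enum I & i != j].

Lemma inner_products_mem i j : i != j -> dot (x i) (x j) \in inner_products i.
Proof.
move=> ij; rewrite mem_undup; apply/mapP; exists j => //.
by rewrite mem_filter ij mem_enum.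
Qed.

Hypothesis le_inner_products : forall i, (size (inner_products i) <= k.+1)%N.
Hypothesis cardI : #|I| = ('C(k.+1 + d, k.+1) + 'C(k + d, k))%N.

Let inner_products1 i : 1 \notin inner_products i.
Proof.
rewrite mem_undup; apply/mapP => -[j]; rewrite mem_filter => /andP [ij _] /esym/eqP.
by rewrite dot_unit_eq1 // (inj_eq x_inj) (negbTE ij).
Qed.

Let cardJ : #|{: monomial_index d.+1 k + monomial_index d.+1 k.+1}| = #|I|.
Proof. by rewrite card_sum !card_monomial_index cardI addnC. Qed.

Let span_lagrange i : spanned (@mono2 _ d.+1 k) (lagrange k.+1 x inner_products i).
Proof. by apply/spannedZ/affine_prod_mono2; rewrite size_pad. Qed.

Let interp := lagrange_interpolation x1 inner_products1 inner_products_mem cardJ span_lagrange.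

Lemma size_inner_products i : (0 < d)%N \/ k = 0 -> size (inner_products i) = k.+1.
Proof.
case=> [d0|k0].
  apply: (size_roots_eq x1 le_inner_products inner_products1 inner_products_mem cardJ span_lagrange) => //.
  by move=> u sn; apply: affine_prod_dot_mono2; rewrite size_pad.
apply/eqP; rewrite eqn_leq le_inner_products k0 lt0n size_eq0; apply/eqP => p0.
have /card_gt0P [j] : (0 < #|predC1 i|)%N.
  by rewrite cardC1 cardI k0 bin1 bin0; lia.
rewrite inE eq_sym => /inner_products_mem.
by rewrite p0.
Qed.

Lemma inner_products_shared i j l : size (inner_products i) = k.+1 -> j != l ->
  dot (x j) (x l) \in inner_products i.
Proof.
move=> si jl.
have [->|ij] := eqVneq i j; first exact: inner_products_mem.
have [->|il] := eqVneq i l; first by rewrite dotC inner_products_mem // eq_sym.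
have top z (s : seq 'rV[R[i]]_d.+1) : dot z z = 0 -> z != 0 -> (size s <= k.+1)%N ->
    \sum_t (node_weight k.+1 inner_products t)%:C%C *
       (dot (cplx (x t)) z ^+ k.+1 * \prod_(a <- s) dot (cplx (x t)) a)
    = if size s == k.+1 then \prod_(a <- s) dot z a else 0.
  move=> z0 zn0 ss.
  apply: (@top_of_interpolation _ _ I (fun t => cplx (x t)) _
    (fun t => [seq c%:C%C | c <- pad k.+1 (inner_products t)])) => //.
    by move=> t; rewrite size_map size_pad.
  move=> w w1; rewrite [RHS](interp (dot_prod_mono2 ss)) //.
  by apply: eq_bigr => t _; rewrite big_map /lagrange /affine_prod; ring.
have rep i1 i2 b : \sum_t node_weight k.+1 inner_products t *
     ((node_poly k.+1 inner_products i1).[dot (x t) (x i1)] * (node_poly k.+1 inner_products i2).[dot (x t) b])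
     = (node_poly k.+1 inner_products i2).[dot (x i1) b].
  rewrite (bigD1 i1) //= x1 mulrA mulVf ?node_poly1_neq0 // mul1r big1 ?addr0 // => t ti.
  by rewrite node_poly_root ?mul0r ?mulr0 // dotC inner_products_mem // eq_sym.
have agree := node_polys_agree x1 top (fun t => eq_leq (size_node_poly le_inner_products t)) rep.
apply: (mem_of_root_node_poly si).
(* The reflection argument breaks down when [x l] is opposite to [x i]; then
   [x j] is not, and the two points exchange their roles. *)
have [li|li] := eqVneq (x l + x i) 0.
  rewrite dotC agree //; first by rewrite node_poly_root // inner_products_mem // eq_sym.
  apply: contra_neq jl => ji; apply: x_inj.
  by apply: (addIr (x i)); rewrite ji li.
by rewrite agree // node_poly_root // inner_products_mem.
Qed.

End Tight.

(** * Antipodal point sets attaining the bound *)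

Section Antipodal.
Variables (R : rcfType) (d n : nat) (I : finType) (x : I -> 'rV[R]_d.+1).
Hypothesis x1 : forall i, dot (x i) (x i) = 1.
Hypothesis x_inj : injective x.
Hypothesis x_opp : forall i j, x i != - x j.

(** In an antipodal set these are the inner products with [x i] other than [1] and
    [-1]. *)
Definition sym_products i : seq R :=
  undup ([seq dot (x i) (x j) | j <- enum I & i != j]
         ++ [seq - dot (x i) (x j) | j <- enum I & i != j]).

Lemma sym_products_mem i j : i != j -> dot (x i) (x j) \in sym_products i.
Proof.
move=> ij; rewrite mem_undup mem_cat; apply/orP; left; apply/mapP; exists j => //.
by rewrite mem_filter ij mem_enum.
Qed.

Lemma sym_products_opp i : perm_eq [seq - c | c <- sym_products i] (sym_products i).
Proof.
apply: uniq_perm; rewrite ?(map_inj_uniq oppr_inj) ?undup_uniq // => c.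
rewrite -{1}[c]opprK (mem_map oppr_inj) !mem_undup !mem_cat orbC.
by congr (_ || _); apply/mapP/mapP => -[j ji cE]; exists j => //;
   apply/oppr_inj; rewrite ?opprK // -cE ?opprK.
Qed.

Hypothesis le_sym_products : forall i, (size (sym_products i) <= n)%N.
Hypothesis cardI : #|I| = 'C(n + d, n).

Local Notation P := (node_poly n sym_products).
Local Notation W := (node_weight n sym_products).

Let sym_products1 i : 1 \notin sym_products i.
Proof.
rewrite mem_undup mem_cat; apply/norP; split; apply/mapP => -[j];
  rewrite mem_filter => /andP [ij _] /esym/eqP.
  by rewrite dot_unit_eq1 // (inj_eq x_inj) (negbTE ij).
by rewrite eqr_oppLR dot_unit_eqN1 // (negbTE (x_opp _ _)).
Qed.

Let cardJ : #|{: monomial_index d.+1 n}| = #|I|.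
Proof. by rewrite card_monomial_index cardI. Qed.

Lemma pad_opp m (s : seq R) :
  perm_eq [seq - c | c <- s] s -> perm_eq [seq - c | c <- pad m s] (pad m s).
Proof. by move=> ss; rewrite map_cat map_nseq oppr0 perm_cat. Qed.

Lemma affine_prod_opp (a : 'rV[R]_d.+1) s z : perm_eq [seq - c | c <- s] s ->
  affine_prod a s (- z) = (-1) ^+ size s * affine_prod a s z.
Proof.
move=> ss; rewrite {2}/affine_prod -(perm_big _ ss) big_map /=.
rewrite -prodrZ_seq.
by apply: eq_bigr => c _; rewrite dotNr rmorphN /=; ring.
Qed.

Lemma node_poly_sign i (b : bool) t : (P i).[(-1) ^+ b * t] = ((-1) ^+ b) ^+ n * (P i).[t].
Proof.
case: b; rewrite ?expr0 ?expr1n ?mul1r // expr1 mulN1r.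
have ss := pad_opp n (sym_products_opp i).
rewrite !horner_prod -(perm_big _ ss) big_map /=.
rewrite -[X in _ ^+ X](size_pad (le_sym_products i)) -prodrZ_seq.
by apply: eq_bigr => c _; rewrite !hornerXsubC /=; ring.
Qed.

Let two_neq0 : 2%:R != 0 :> R[i]. Proof. by rewrite pnatr_eq0. Qed.

Let span_lagrange i : spanned (@mono _ d.+1 n) (lagrange n x sym_products i).
Proof.
apply/spannedZ/mono_parity => //.
  by apply: affine_prod_mono2; rewrite size_pad.
by move=> z _; rewrite affine_prod_opp ?size_pad // pad_opp ?sym_products_opp.
Qed.

Let interp := lagrange_interpolation x1 sym_products1 sym_products_mem cardJ span_lagrange.

Lemma size_sym_products i : (0 < d)%N \/ n = 0 -> size (sym_products i) = n.
Proof.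
case=> [d0|n0]; last by have := le_sym_products i; rewrite n0 leqn0 => /eqP.
apply: (size_roots_eq x1 le_sym_products sym_products1 sym_products_mem cardJ span_lagrange) => //.
move=> u sn; have sp : size (pad n.-1 (sym_products i)) = n.-1.
  by rewrite size_pad //; lia.
apply: mono_parity => //; first by apply: affine_prod_dot_mono2; rewrite sp leq_pred.
move=> z _; rewrite affine_prod_opp ?pad_opp ?sym_products_opp // sp dotNr.
by case: n sn => // m _; rewrite exprS /=; ring.
Qed.

(** All points of the antipodal set, indexed by a representative and a sign. *)
Definition signed (p : I * bool) := (-1) ^+ p.2 *: x p.1.

Let signed1 p : dot (signed p) (signed p) = 1.
Proof. by rewrite /signed !dotE x1 mulr1 -expr2 sqrr_sign. Qed.

(** The sums over both signs vanish when [n + size s] is odd. Otherwise the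
    product of [s] is, on the quadric, a form of degree [n], to which the
    interpolation formula at the representatives applies. *)
Lemma signed_top z (s : seq 'rV[R[i]]_d.+1) :
  dot z z = 0 -> z != 0 -> (size s <= n)%N ->
  \sum_p (W p.1 / 2)%:C%C *
     (dot (cplx (signed p)) z ^+ n * \prod_(a <- s) dot (cplx (signed p)) a)
  = if size s == n then \prod_(a <- s) dot z a else 0.
Proof.
move=> z0 zn0 ss.
have cplx_signed p : cplx (signed p) = (-1) ^+ p.2 *: cplx (x p.1).
  by rewrite /cplx map_mxZ rmorphXn rmorphN1.
have prod_sign p : \prod_(a <- s) dot (cplx (signed p)) a
    = ((-1) ^+ p.2) ^+ size s * \prod_(a <- s) dot (cplx (x p.1)) a.
  rewrite cplx_signed -prodrZ_seq.
  by apply: eq_bigr => a _; rewrite dotZl.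
have aff_sign (p : I * bool) w : affine_prod (signed p) (pad n (sym_products p.1)) w
    = ((-1) ^+ p.2) ^+ n * affine_prod (x p.1) (pad n (sym_products p.1)) w.
  rewrite {1}/affine_prod cplx_signed; case: p => i [] /=; last first.
    by rewrite expr0 scale1r expr1n mul1r.
  rewrite expr1 -{2}(size_pad (le_sym_products i)).
  rewrite -affine_prod_opp ?pad_opp ?sym_products_opp //.
  by apply: eq_bigr => c _; rewrite scaleN1r dotNl dotNr.
have [par|par] := boolP (odd (n + size s)).
  rewrite ifN; last by apply: contraTneq par => ->; rewrite oddD addbb.
  rewrite (eq_bigr (fun p : I * bool => (-1) ^+ p.2 * ((W p.1 / 2)%:C%C *
     (dot (cplx (x p.1)) z ^+ n * \prod_(a <- s) dot (cplx (x p.1)) a)))).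
    rewrite -(pair_bigA _ (fun i (b : bool) => (-1) ^+ b * ((W i / 2)%:C%C *
     (dot (cplx (x i)) z ^+ n * \prod_(a <- s) dot (cplx (x i)) a)))) /= big1 // => i _.
    by rewrite big_bool /= expr1 expr0; ring.
  move=> p _; rewrite prod_sign cplx_signed dotZl exprMn.
  have eE : (-1) ^+ p.2 = ((-1) ^+ p.2) ^+ n * ((-1) ^+ p.2) ^+ size s :> R[i].
    rewrite -exprD; case: p.2; rewrite ?expr0 ?expr1n // expr1.
    by rewrite -signr_odd par expr1.
  by rewrite [X in _ = X * _]eE; ring.
apply: (@top_of_interpolation _ _ _ (fun p => cplx (signed p)) _
    (fun p => [seq c%:C%C | c <- pad n (sym_products p.1)])) => //.
  by move=> t; rewrite size_map size_pad.
move=> w w1.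
have sg : (-1) ^+ size s = (-1) ^+ n :> R[i].
  rewrite -signr_odd -[RHS]signr_odd.
  by move: par; rewrite oddD; case: (odd n); case: (odd _).
have sp : spanned (@mono _ d.+1 n) (fun z => \prod_(a <- s) dot z a).
  apply: mono_parity => //; first by apply: dot_prod_mono2; apply: leqW.
  move=> u _; rewrite -sg -prodrZ_seq.
  by apply: eq_bigr => a _; rewrite dotNl mulN1r.
rewrite [RHS](interp sp) //.
rewrite -(pair_bigA _ (fun i b => (W i / 2)%:C%C * \prod_(a <- s) dot (cplx (signed (i, b))) a
  * \prod_(c <- [seq c%:C%C | c <- pad n (sym_products i)]) (dot (cplx (signed (i, b))) w - c))) /=.
apply: eq_bigr => i _; rewrite big_bool /= !big_map.
rewrite -!/(affine_prod (signed _) _ _) !prod_sign (aff_sign (i, true)) (aff_sign (i, false)) /=.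
have W2 : (W i / 2)%:C%C = (W i)%:C%C / 2 :> R[i].
  by rewrite rmorphM /=; congr (_ * _); rewrite fmorphV rmorph_nat.
rewrite expr0 !expr1n expr1 /lagrange W2.
have sq : (-1) ^+ n * (-1) ^+ n = 1 :> R[i] by rewrite -expr2 sqrr_sign.
rewrite sg; set A := \prod_(a <- s) _; set B := affine_prod _ _ _.
transitivity ((W i)%:C%C * A * B * (((-1) ^+ n * (-1) ^+ n + 1) / 2)).
  by field.
by rewrite sq; field.
Qed.

Lemma signed_reproducing i j c b :
  \sum_p W p.1 / 2 * ((P i).[dot (signed p) (signed (i, c))] * (P j).[dot (signed p) b])
  = (P j).[dot (signed (i, c)) b].
Proof.
rewrite (eq_bigr (fun p : I * bool => ((-1) ^+ c) ^+ n * (W p.1 / 2 *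
   ((P i).[dot (x p.1) (x i)] * (P j).[dot (x p.1) b])))); last first.
  move=> [t e] _; rewrite /signed /= !dotE.
  rewrite !node_poly_sign.
  have sq : ((-1) ^+ e) ^+ n * ((-1) ^+ e) ^+ n = 1 :> R.
    by rewrite -expr2 -!exprM -signr_odd !oddM !andbF.
  by rewrite -[RHS]mul1r -[X in _ = X * _]sq; ring.
rewrite -(pair_bigA _ (fun t (e : bool) => ((-1) ^+ c) ^+ n * (W t / 2 *
   ((P i).[dot (x t) (x i)] * (P j).[dot (x t) b])))) /=.
rewrite (bigD1 i) //= [X in _ + X]big1 => [|t ti].
  rewrite addr0 big_bool /= x1 /signed /= dotZl node_poly_sign.
  have := node_poly1_neq0 n sym_products1 i; rewrite /node_weight => Pn0.
  by field.
rewrite big_bool /= node_poly_root ?mul0r ?mulr0 ?addr0 //.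
by rewrite dotC sym_products_mem // eq_sym.
Qed.

(** No representative is opposite to another one, so that the reflection argument
    applies to all of them. *)
Lemma sym_products_shared i j l : size (sym_products i) = n -> j != l ->
  dot (x j) (x l) \in sym_products i.
Proof.
move=> si jl.
have [->|ij] := eqVneq i j; first exact: sym_products_mem.
have [->|il] := eqVneq i l; first by rewrite dotC sym_products_mem // eq_sym.
apply: (mem_of_root_node_poly si).
have agree := @node_polys_agree _ _ _ signed (fun p => W p.1 / 2) n signed1 signed_top
  (fun p => P p.1) (fun p => eq_leq (size_node_poly le_sym_products p.1)).
have {}agree := agree (fun p q b => signed_reproducing p.1 q.1 p.2 b).
have /= := agree (i, false) (j, false) (x l) (x1 l).
rewrite /signed /= expr0 !scale1r => ->.
  by rewrite node_poly_root // sym_products_mem.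
by rewrite addr_eq0 x_opp.
Qed.

End Antipodal.

(** * Sets of distances *)

Local Open Scope classical_set_scope.
Local Open Scope card_scope.

Section Sets.
Variables (R : realType) (d : nat).
Implicit Types (X : set 'rV[R]_d) (L : seq R).

Lemma card_set_seq (V : zmodType) (s : seq V) : uniq s -> [set` s] #= `I_(size s).
Proof.
move=> us; have -> : [set` s] = (nth 0 s) @` `I_(size s).
  apply/seteqP; split=> [y /= ys|_ [i /= si <-]]; last exact: mem_nth.
  by exists (index y s); rewrite /= ?index_mem // nth_index.
apply: inj_card_eq => i j; rewrite !inE /= => si sj /eqP.
by rewrite nth_uniq // => /eqP.
Qed.

Lemma set_seq_of_card (V : zmodType) (X : set V) n : X #= `I_n ->
  exists s : seq V, [/\ uniq s, size s = n & forall y, X y <-> y \in s].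
Proof.
move=> Xn; have /finite_seqP [s Xs] : finite_set X by apply/finite_setP; exists n.
have XE y : X y <-> y \in undup s by rewrite mem_undup Xs.
exists (undup s); split; rewrite ?undup_uniq //; apply/card_eq_II.
rewrite -(card_eql (card_set_seq (undup_uniq s))).
have <- : X = [set` undup s] by apply/seteqP; split=> y /XE.
by [].
Qed.

Lemma unit_sphereP (y : 'rV[R]_d) : unit_sphere R d y <-> dot y y = 1.
Proof.
have -> : unit_sphere R d y = (Num.sqrt (dot y y) = 1).
  rewrite /unit_sphere /= /edist /dot; congr (Num.sqrt _ = 1).
  by apply: eq_bigr => i _; rewrite mxE subr0 expr2.
split=> [h|->]; last exact: sqrtr1.
by rewrite -(sqr_sqrtr (dot_ge0 y)) h expr1n.
Qed.

(** The distance between two points of the unit sphere with inner product [c]. *)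
Definition chord (c : R) := Num.sqrt (2 - 2 * c).

Lemma edist_chord (y z : 'rV[R]_d) : dot y y = 1 -> dot z z = 1 ->
  edist y z = chord (dot y z).
Proof.
move=> y1 z1; rewrite /edist /chord; congr Num.sqrt.
transitivity (dot (y - z) (y - z)).
  by apply: eq_bigr => i _; rewrite !mxE expr2.
by rewrite !dotE y1 z1 (dotC z y); ring.
Qed.

Lemma dot_unit_le1 (y z : 'rV[R]_d) : dot y y = 1 -> dot z z = 1 -> dot y z <= 1.
Proof.
move=> y1 z1; have := dot_ge0 (y - z).
by rewrite !dotE y1 z1 (dotC z y) => h; lra.
Qed.

Lemma chord_inj : {in [pred c | c <= 1] &, injective chord}.
Proof.
move=> a b; rewrite !inE => a1 b1 /(congr1 (fun t => t ^+ 2)).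
by rewrite !sqr_sqrtr; try lra.
Qed.

Section Lists.
Variables (X : set 'rV[R]_d) (y : 'rV[R]_d) (L : seq R).
Hypothesis X1 : forall z, X z -> dot z z = 1.
Hypothesis Xy : X y.
Hypothesis uL : uniq L.
Hypothesis LX : forall c, c \in L -> exists z, [/\ X z, z <> y & dot y z = c].

Let uniq_chord : uniq (map chord L).
Proof.
rewrite map_inj_in_uniq // => a b /LX [z [Xz _ <-]] /LX [w [Xw _ <-]].
by apply: chord_inj; rewrite inE dot_unit_le1 ?X1.
Qed.

Let chord_distances : [set` map chord L] `<=` distances_from X y.
Proof.
move=> r /= /mapP [c /LX [z [Xz zy <-]] ->].
by exists z; split=> //; rewrite edist_chord ?X1.
Qed.

Lemma local_size k : locally_k_distance_set k X -> (size L <= k)%N.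
Proof.
move=> /(_ y Xy) Xk; rewrite -card_le_II -(size_map chord).
rewrite -(card_le_eql (card_set_seq uniq_chord)).
exact: card_le_trans (subset_card_le chord_distances) Xk.
Qed.

Lemma k_distance_size :
  (forall z w, X z -> X w -> z <> w -> dot z w \in L) ->
  k_distance_set (size L) X.
Proof.
move=> XL; rewrite /k_distance_set.
suff -> : distances X = [set` map chord L].
  by rewrite -(size_map chord); apply: card_set_seq.
apply/seteqP; split=> [r [z [w [Xz Xw zw ->]]]|r /chord_distances [z [Xz zy ->]]].
  by rewrite /= edist_chord ?X1 //; apply/map_f/XL.
by exists y, z; split=> // /esym.
Qed.

End Lists.
End Sets.

Section Theorems.
Variables (R : realType) (d k : nat).

Lemma tight_k_distance (X : set 'rV[R]_d.+1) : (0 < d)%N \/ k = 0%N ->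
  X `<=` unit_sphere R d.+1 -> locally_k_distance_set k.+1 X ->
  X #= `I_(Nbound d.+1 k.+1) -> k_distance_set k.+1 X.
Proof.
move=> hdk XS Xk /set_seq_of_card [s [us sN Xs]].
have X1 z : X z -> dot z z = 1 by move=> /XS /unit_sphereP.
pose x (i : 'I_(size s)) := s`_i.
have Xx i : X (x i) by apply/Xs; rewrite mem_nth.
have x1 i : dot (x i) (x i) = 1 by apply: X1.
have x_inj : injective x.
  by move=> i j /eqP; rewrite nth_uniq // => /eqP /val_inj.
have xX z : X z -> exists i, z = x i.
  move=> /Xs zs; have iz : (index z s < size s)%N by rewrite index_mem.
  by exists (Ordinal iz); rewrite /x /= nth_index.
have prodX i c : c \in inner_products x i -> exists z, [/\ X z, z <> x i & dot (x i) z = c].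
  rewrite mem_undup => /mapP [j]; rewrite mem_filter => /andP [ij _] ->.
  by exists (x j); split=> // /x_inj /eqP; rewrite eq_sym (negbTE ij).
have up i : uniq (inner_products x i) by apply: undup_uniq.
have le_inner_products i : (size (inner_products x i) <= k.+1)%N.
  exact: (local_size X1 (Xx i) (up i) (prodX i)).
have cardI : #|'I_(size s)| = ('C(k.+1 + d, k.+1) + 'C(k + d, k))%N.
  rewrite card_ord sN /Nbound; congr ('C(_, _) + 'C(_, _))%N; lia.
have sp i := size_inner_products x1 x_inj le_inner_products cardI i hdk.
have i0 : 'I_(size s).
  have s0 : (0 < size s)%N by move: cardI; rewrite card_ord => ->; rewrite addn_gt0 bin_gt0 leq_addr.
  exact: (Ordinal s0).
rewrite -(sp i0); apply: (k_distance_size X1 (Xx i0) (up i0) (prodX i0)).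
move=> z w /xX [j ->] /xX [l ->] jl.
apply: (inner_products_shared x1 x_inj le_inner_products cardI (sp i0)).
by apply/eqP => jl'; apply: jl; rewrite jl'.
Qed.

(** Of two opposite vectors, the one that comes first in [s] is kept. *)
Lemma half_of_antipodal (s : seq 'rV[R]_d.+1) : uniq s ->
  (forall z, z \in s -> - z \in s) -> 0 \notin s ->
  exists h : seq 'rV[R]_d.+1, [/\ uniq h, size s = (2 * size h)%N,
    forall z, (z \in s) = (z \in h) || (- z \in h) &
    forall z, z \in h -> - z \notin h].
Proof.
move=> us sN s0.
pose P z := (index z s < index (- z) s)%N.
have sNE z : (- z \in s) = (z \in s).
  by apply/idP/idP => [/sN|/sN//]; rewrite opprK.
have PN z : z \in s -> P (- z) = ~~ P z.
  move=> zs; rewrite /P opprK -leqNgt ltn_neqAle.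
  have -> // : index (- z) s != index z s.
  apply/eqP => /(congr1 (nth 0 s)); rewrite !nth_index ?sN // => /eqP.
  rewrite eq_sym -addr_eq0 -mulr2n -scaler_nat scaler_eq0 pnatr_eq0 /= => /eqP z0.
  by move: s0; rewrite -z0 zs.
have hE z : (z \in [seq z <- s | P z]) = (z \in s) && P z by rewrite mem_filter andbC.
exists [seq z <- s | P z]; split.
- exact: filter_uniq.
- rewrite -(count_predC P s) -!size_filter mul2n -addnn; congr (_ + _)%N.
  rewrite -[RHS](size_map -%R); apply/perm_size/uniq_perm.
  + exact: filter_uniq.
  + by rewrite (map_inj_uniq oppr_inj) filter_uniq.
  move=> z; rewrite mem_filter /= -[in RHS](opprK z) (mem_map oppr_inj) hE sNE andbC.
  by case zs: (z \in s) => //=; rewrite PN.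
- move=> z; rewrite !hE sNE; case zs: (z \in s) => //=.
  by rewrite PN //; case: (P z).
move=> z; rewrite !hE sNE => /andP [zs Pz].
by rewrite zs PN // Pz.
Qed.

Lemma antipodal_tight_k_distance (X : set 'rV[R]_d.+1) : (0 < d)%N \/ k = 0%N ->
  X `<=` unit_sphere R d.+1 -> antipodal X -> locally_k_distance_set k.+1 X ->
  X #= `I_(Nbound_antipodal d.+1 k.+1) -> k_distance_set k.+1 X.
Proof.
move=> hdk XS XN Xk /set_seq_of_card [s [us sN Xs]].
have X1 z : X z -> dot z z = 1 by move=> /XS /unit_sphereP.
have sopp z : z \in s -> - z \in s by move=> /Xs /XN /Xs.
have s0 : 0 \notin s.
  by apply/negP => /Xs /X1 /eqP; rewrite dot0l eq_sym oner_eq0.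
have [h [uh sh hs hN]] := half_of_antipodal us sopp s0.
pose x (i : 'I_(size h)) := h`_i.
have xh i : x i \in h by rewrite mem_nth.
have Xx i : X (x i) by apply/Xs; rewrite hs xh.
have x1 i : dot (x i) (x i) = 1 by apply: X1.
have x_inj : injective x.
  by move=> i j /eqP; rewrite nth_uniq // => /eqP /val_inj.
have x_opp i j : x i != - x j.
  by apply: contraTneq (xh i) => ->; apply: hN.
have xX z : X z -> exists i, exists b : bool, z = (-1) ^+ b *: x i.
  have hx w : w \in h -> exists i, w = x i.
    move=> wh; have iw : (index w h < size h)%N by rewrite index_mem.
    by exists (Ordinal iw); rewrite /x /= nth_index.
  move=> /Xs; rewrite hs => /orP [/hx [i ->]|/hx [i zi]]; exists i.
    by exists false; rewrite scale1r.
  by exists true; rewrite scaleN1r -zi opprK.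
(* The distance to the antipode corresponds to the inner product -1; it uses up
   one of the [k.+1] distances, whence the degree [k]. *)
pose L i := -1 :: sym_products x i.
have uL i : uniq (L i).
  rewrite /= undup_uniq andbT mem_undup mem_cat; apply/norP.
  split; apply/mapP => -[j]; rewrite mem_filter => /andP [ij _] /esym/eqP.
    by rewrite dot_unit_eqN1 // (negbTE (x_opp _ _)).
  by rewrite eqr_opp dot_unit_eq1 // (inj_eq x_inj) (negbTE ij).
have LX i c : c \in L i -> exists z, [/\ X z, z <> x i & dot (x i) z = c].
  rewrite inE mem_undup mem_cat => /or3P [/eqP ->|/mapP [j]|/mapP [j]].
  - exists (- x i); split; [exact: XN|apply/eqP|by rewrite dotNr x1].
    by rewrite eq_sym x_opp.
  - rewrite mem_filter => /andP [ij _] ->; exists (x j); split=> // /x_inj /eqP.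
    by rewrite eq_sym (negbTE ij).
  - move=> _ ->; exists (- x j); split; [exact: XN|apply/eqP|by rewrite dotNr].
    by rewrite eq_sym x_opp.
have le_sym i : (size (sym_products x i) <= k)%N.
  exact: (local_size X1 (Xx i) (uL i) (LX i) Xk).
have cardI : #|'I_(size h)| = 'C(k + d, k).
  have : (2 * size h = 2 * 'C(k + d, k))%N.
    by rewrite -sh sN /Nbound_antipodal; congr (2 * 'C(_, _))%N; lia.
  by rewrite card_ord; lia.
have sp i := size_sym_products x1 x_inj x_opp le_sym cardI i hdk.
have i0 : 'I_(size h).
  have h0 : (0 < size h)%N by move: cardI; rewrite card_ord => ->; rewrite bin_gt0 leq_addr.
  exact: (Ordinal h0).
have -> : k.+1 = size (L i0) by rewrite /= sp.
apply: (k_distance_size X1 (Xx i0) (uL i0) (LX i0)).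
move=> z w /xX [j [b ->]] /xX [l [c ->]] zw.
rewrite dotZl dotZr mulrA -signr_addb.
have [jl|jl] := eqVneq j l.
  move: zw; rewrite jl x1 mulr1 inE.
  by case: b c => [] [] //= _; rewrite eqxx.
have := sym_products_shared x1 x_inj x_opp le_sym cardI (sp i0) jl.
rewrite inE => jlm; apply/orP; right; case: (b (+) c); rewrite ?mul1r ?mulN1r //.
by rewrite -(perm_mem (sym_products_opp x i0)) (mem_map oppr_inj).
Qed.

End Theorems.

(* On the line both bounds equal 2 for every k, while the two-point set {-1, 1}
   realizes a single distance; hdk excludes exactly the pairs d = 1, k >= 2. *)
Theorem theorem1p3 (R : realType) (d k : nat)
    (hd : (0 < d)%N) (hk : (0 < k)%N) (hdk : (1 < d)%N \/ k = 1%N) :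
  (forall X : set 'rV[R]_d,
     X `<=` unit_sphere R d ->
     locally_k_distance_set k X ->
     X #= `I_(Nbound d k) ->
     k_distance_set k X)
  /\
  (forall X : set 'rV[R]_d,
     X `<=` unit_sphere R d ->
     antipodal X ->
     locally_k_distance_set k X ->
     X #= `I_(Nbound_antipodal d k) ->
     k_distance_set k X).
Proof.
case: d hd hdk => // d _; case: k hk => // k _ hdk.
have hdk' : (0 < d)%N \/ k = 0%N by case: hdk => [|[]]; [left|right].
by split=> X; [apply: tight_k_distance | apply: antipodal_tight_k_distance].
Qed.
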